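(* Let $\mathcal L$ be a differentiable real-valued function of a real matrix $W$ that is $L$-smooth and bounded below by $\mathcal L_{\inf}$, let $W_0$ be an initial point and $\Delta_0:=\mathcal L(W_0)-\mathcal L_{\inf}$. Let $W_0,\dots,W_{T+1}$ be generated by NormPre-L with the sketch-based implementation (defined in the context), under a fixed orientation $k$, with constant step size $\eta$. For every $t$ and all row indices $i,j$, let $\phi_{t,i}$ be the angle between $\bar g_{t,i}$ and $\bar w_{t,i}$ and $\phi'_{t,j,i}$ the angle between $\psi_{t,j}$ and $\bar w_{t,i}$. Suppose that along this sequence $$\sin\phi_{t,i}\ge\gamma>0\quad\text{and}\quad\Big(\sum_{j}\cos^2\phi'_{t,j,i}\Big)^{1/2}\le\gamma'\qquad\text{for all }t,i,$$ and that, with $\nu_t:=\max_i\|\bar g_{t,i}-x_{t,i}\|_2/\|x_{t,i}\|_2$ and $\chi_t:=\widetilde\sigma_{t,1}=\sqrt{\lambda_{t,1}}$, there exists $\epsilon>0$ such that $\max_{0\le t\le T}\nu_t\gamma'\chi_t\le1-\epsilon$. Let $P_t$ and $\widehat P_t$ denote the exact and the sketch-based localized spectral preconditioners constructed from the same $\Psi_t$. Assume that there exists $\delta\ge0$ such that $\|\widehat P_t-P_t\|_{\mathrm{op}}\le\delta$ for all $t$ and $\delta\max_{0\le t\le T}\lambda_{t,1}<\epsilon\gamma$. Then for any constant $C>0$, choosing $\eta=C/\sqrt{T+1}$ gives $$\min_{0\le t\le T}\|\nabla\mathcal L(W_t)\|_F\le\frac{1}{\sqrt{T+1}}\left(\frac{\Delta_0\max\{m,n\}^{1/2}}{\left(\epsilon\gamma-\delta\max_{0\le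 t\le T}\lambda_{t,1}\right)C}+\frac{LC\max\{m,n\}^{3/2}}{2\left(\epsilon\gamma-\delta\max_{0\le t\le T}\lambda_{t,1}\right)}\right).$$
   Context: Orientation. Fix $k\in\{0,1\}$ and let $\mathcal O_0(A)=A$, $\mathcal O_1(A)=A^\top$. The parameters $W_t$ are real matrices such that $\overline W_t:=\mathcal O_k(W_t)\in\mathbb R^{m\times n}$. $L$-smooth means that $\nabla\mathcal L$ is $L$-Lipschitz with respect to the Frobenius norm. One step (no stochastic gradients, momentum, RMS scaling or weight decay). Let $G_t:=\nabla\mathcal L(W_t)$, $\overline G_t:=\mathcal O_k(G_t)\in\mathbb R^{m\times n}$, and let $\bar w_{t,i}$, $\bar g_{t,i}$ be the $i$-th rows of $\overline W_t$, $\overline G_t$. The relaxed tangent gradient $X_t\in\mathbb R^{m\times n}$ has rows $x_{t,i}:=\bar g_{t,i}-\langle\bar g_{t,i},\bar w_{t,i}\rangle\,\bar w_{t,i}$ (with no division by $\|\bar w_{t,i}\|_2^2$). Let $D(X_t):=\operatorname{Diag}(\|x_{t,1}\|_2,\dots,\|x_{t,m}\|_2)$ and $\Psi_t:=D(X_t)^{-1}X_t$, with rows $\psi_{t,i}=x_{t,i}/\|x_{t,i}\|_2$. It is assumed throughout that all $x_{t,i}\ne0$ (the normalization is well defined) and that all $\bar g_{t,i},\bar w_{t,i}$ are nonzero (so the angles are defined). Let $\Gamma_t:=\Psi_t\Psi_t^\top=\widetilde U_t\Lambda_t\widetilde U_t^\top$ be an eigendecomposition with $\Lambda_t=\operatorname{Diag}(\lambda_{t,1},\dots,\lambda_{t,m})$,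 $\lambda_{t,1}\ge\dots\ge\lambda_{t,m}\ge0$, and $\widetilde\sigma_{t,i}:=\sqrt{\lambda_{t,i}}$. A rank budget $1\le r\le m$ is fixed. Exact localized preconditioner. Let $\mathcal A_t:=\{i:\lambda_{t,i}>1\}$ and let $\mathcal C_t\subseteq\mathcal A_t$ index the $\min\{r,|\mathcal A_t|\}$ largest eigenvalues in $\mathcal A_t$ (ties broken arbitrarily). Then $P_t:=I_m+\widetilde U_{\mathcal C_t}(\Lambda_{\mathcal C_t}^{-1/2}-I)\widetilde U_{\mathcal C_t}^\top$, where $\widetilde U_{\mathcal C_t}$ consists of the columns of $\widetilde U_t$ indexed by $\mathcal C_t$ and $\Lambda_{\mathcal C_t}:=\operatorname{Diag}(\lambda_{t,i})_{i\in\mathcal C_t}$. Sketch-based localized preconditioner. Given an oversampling parameter $o\ge0$ and a number $p\ge0$ of power iterations, put $\ell:=\min\{m,r+o\}$; draw $\Omega\in\mathbb R^{n\times\ell}$ with i.i.d. standard Gaussian entries; set $Y:=\Psi_t\Omega$ and apply $Y\leftarrow\Psi_t(\Psi_t^\top Y)$ $p$ times; let $Q\in\mathbb R^{m\times\ell}$ be the orthonormal-column factor of a QR decomposition of $Y$; let $(Z,\widehat\Lambda)$, $Z\in\mathbb R^{\ell\times r}$ with orthonormal columns, be the top-$r$ eigenpairs of $(Q^\top\Psi_t)(Q^\top\Psi_t)^\top$; set $\widehat U:=QZ$; retain the index set $\widehat{\mathcal C}_t:=\{i:\widehat\lambda_{t,i}>1\}$, where $\widehat\lambda_{t,i}$ are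 the diagonal entries of $\widehat\Lambda$. Then $\widehat P_t:=I_m+\widehat U_{\widehat{\mathcal C}_t}(\widehat\Lambda_{\widehat{\mathcal C}_t}^{-1/2}-I)\widehat U_{\widehat{\mathcal C}_t}^\top$, the subscript denoting restriction to the retained columns/eigenvalues. The exact and sketch-based index sets may differ. NormPre-L with the sketch-based implementation performs the update $W_{t+1}=W_t-\eta\,\mathcal O_k^{-1}(\widehat T_t)$ with $\widehat T_t:=\widehat P_t\Psi_t$. The statement is for the realized sequence of iterates (the hypotheses are imposed on that realization). *)

(* Defs.v *)
(* MathComp / MathComp-Analysis. *)
From HB Require Import structures.
From mathcomp Require Import all_boot all_order all_algebra.
From mathcomp Require Import all_classical all_reals all_analysis.

Set Implicit Arguments.
Unset Strict Implicit.
Unset Printing Implicit Defensive.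

Import Order.TTheory GRing.Theory Num.Theory.
Import numFieldNormedType.Exports.

Local Open Scope classical_set_scope.
Local Open Scope ring_scope.

(* The maximum and minimum of f 0, ..., f T; starting the fold at f 0 rather
   than at a constant makes them correct whatever the signs of the f t. *)
Definition max_upto (R : realType) (T : nat) (f : nat -> R) : R :=
  \big[Num.max/f 0%N]_(t < T.+1) f t.

Definition min_upto (R : realType) (T : nat) (f : nat -> R) : R :=
  \big[Num.min/f 0%N]_(t < T.+1) f t.

Definition dotv (R : realType) (n : nat) (u v : 'rV[R]_n) : R :=
  \sum_(j < n) u 0 j * v 0 j.

(* The library norm `|A| on matrices is the sup norm.  On a row or a column
   vector, fnorm is the Euclidean norm. *)
Definition fnorm (R : realType) (m n : nat) (A : 'M[R]_(m, n)) : R :=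
  Num.sqrt (\sum_(i < m) \sum_(j < n) A i j ^+ 2).

Definition opnorm (R : realType) (m n : nat) (A : 'M[R]_(m, n)) : R :=
  sup [set fnorm (A *m x) | x in [set x : 'cV[R]_n | fnorm x <= 1]].

Definition angle (R : realType) (n : nat) (u v : 'rV[R]_n) : R :=
  acos (dotv u v / (fnorm u * fnorm v)).

(* Meant for differentiable f: the matrix of partial derivatives then
   represents the differential through the Frobenius inner product. *)
Definition gradient (R : realType) (a b : nat) (f : 'M[R]_(a, b) -> R)
    (W : 'M[R]_(a, b)) : 'M[R]_(a, b) :=
  \matrix_(i < a, j < b) 'D_(delta_mx i j) f W.

Definition smooth_fun (R : realType) (a b : nat) (L : R)
    (f : 'M[R]_(a, b) -> R) : Prop :=
  (forall W, differentiable f W) /\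
  (forall V W, fnorm (gradient f V - gradient f W) <= L * fnorm (V - W)).

(* The orientation k is false for the identity and true for transposition; a
   parameter W has the shape for which orient k W is m x n. *)
Definition wrows (k : bool) (m n : nat) : nat := if k then n else m.
Definition wcols (k : bool) (m n : nat) : nat := if k then m else n.

Definition orient (R : realType) (k : bool) (m n : nat) :
    'M[R]_(wrows k m n, wcols k m n) -> 'M[R]_(m, n) :=
  match k with
  | false => fun A => A
  | true => fun A => A^T
  end.

Definition orient_inv (R : realType) (k : bool) (m n : nat) :
    'M[R]_(m, n) -> 'M[R]_(wrows k m n, wcols k m n) :=
  match k with
  | false => fun A => A
  | true => fun A => A^T
  end.

Definition relaxed_tangent (R : realType) (m n : nat) (G W : 'M[R]_(m, n)) :
    'M[R]_(m, n) :=
  \matrix_(i < m) (row i G - dotv (row i G) (row i W) *: row i W).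

(* D(X)^-1 X, where D(X) is the diagonal matrix of the row norms of X. *)
Definition row_normalize (R : realType) (m n : nat) (X : 'M[R]_(m, n)) :
    'M[R]_(m, n) :=
  \matrix_(i < m) ((fnorm (row i X))^-1 *: row i X).

Definition gbar (R : realType) (k : bool) (m n : nat)
    (f : 'M[R]_(wrows k m n, wcols k m n) -> R)
    (W : 'M[R]_(wrows k m n, wcols k m n)) : 'M[R]_(m, n) :=
  orient (gradient f W).

Definition tangent_of (R : realType) (k : bool) (m n : nat)
    (f : 'M[R]_(wrows k m n, wcols k m n) -> R)
    (W : 'M[R]_(wrows k m n, wcols k m n)) : 'M[R]_(m, n) :=
  relaxed_tangent (gbar f W) (orient W).

Definition Psi_of (R : realType) (k : bool) (m n : nat)
    (f : 'M[R]_(wrows k m n, wcols k m n) -> R)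
    (W : 'M[R]_(wrows k m n, wcols k m n)) : 'M[R]_(m, n) :=
  row_normalize (tangent_of f W).

(* The default value 0 of the maximum is harmless: all terms are >= 0. *)
Definition nu_of (R : realType) (k : bool) (m n : nat)
    (f : 'M[R]_(wrows k m n, wcols k m n) -> R)
    (W : 'M[R]_(wrows k m n, wcols k m n)) : R :=
  \big[Num.max/0]_(i < m)
    (fnorm (row i (gbar f W) - row i (tangent_of f W))
       / fnorm (row i (tangent_of f W))).

Definition eigendecomposition (R : realType) (q : nat) (S U : 'M[R]_q)
    (lam : 'rV[R]_q) : Prop :=
  [/\ U^T *m U = 1%:M,
      S = U *m diag_mx lam *m U^T,
      forall i j : 'I_q, (i <= j)%N -> lam 0 j <= lam 0 i
    & forall i : 'I_q, 0 <= lam 0 i].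

Definition largest_eigenvalue (R : realType) (q : nat) (q_gt0 : (0 < q)%N)
    (lam : 'rV[R]_q) : R :=
  lam 0 (Ordinal q_gt0).

(* I + U_C (Lam_C^(-1/2) - I) U_C^T, where U_C keeps the columns of U indexed
   by C, in increasing order. *)
Definition localized_preconditioner (R : realType) (m q : nat)
    (U : 'M[R]_(m, q)) (lam : 'rV[R]_q) (C : {set 'I_q}) : 'M[R]_m :=
  let UC := colsub (fun a : 'I_#|C| => enum_val a) U in
  let LC := diag_mx (\row_(a < #|C|) (Num.sqrt (lam 0 (enum_val a)))^-1) in
  1%:M + UC *m (LC - 1%:M) *m UC^T.

Definition above_one (R : realType) (q : nat) (lam : 'rV[R]_q) : {set 'I_q} :=
  [set i | 1 < lam 0 i]%SET.

(* C indexes min(r, #|A|) largest eigenvalues in A = above_one lam, ties being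
   broken arbitrarily. *)
Definition exact_index_set (R : realType) (q r : nat) (lam : 'rV[R]_q)
    (C : {set 'I_q}) : Prop :=
  [/\ C \subset above_one lam,
      #|C| = minn r #|above_one lam|
    & forall i j, i \in C -> j \in (above_one lam :\: C)%SET ->
        lam 0 j <= lam 0 i].

Definition exact_preconditioner (R : realType) (m n r : nat)
    (Psi : 'M[R]_(m, n)) (lam : 'rV[R]_m) (P : 'M[R]_m) : Prop :=
  exists (U : 'M[R]_m) (C : {set 'I_m}),
    [/\ eigendecomposition (Psi *m Psi^T) U lam,
        exact_index_set r lam C
      & P = localized_preconditioner U lam C].

Definition sketch_dim (m r o : nat) : nat := minn m (r + o).

Lemma rank_le_sketch_dim (m r o : nat) : (r <= m)%N -> (r <= sketch_dim m r o)%N.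
Proof. by move=> rm; rewrite /sketch_dim leq_min rm leq_addr. Qed.

(* Q is the orthonormal-column factor of some (thin) QR decomposition of Y;
   is_trig_mx means lower triangular. *)
Definition qr_orthonormal_factor (R : realType) (m l : nat)
    (Y Q : 'M[R]_(m, l)) : Prop :=
  Q^T *m Q = 1%:M /\
  exists2 B : 'M[R]_l, is_trig_mx B^T & Y = Q *m B.

(* The leading r pairs of some eigendecomposition of S. *)
Definition top_eigenpairs (R : realType) (l r : nat) (rl : (r <= l)%N)
    (S : 'M[R]_l) (Z : 'M[R]_(l, r)) (lamhat : 'rV[R]_r) : Prop :=
  exists (V : 'M[R]_l) (mu : 'rV[R]_l),
    [/\ eigendecomposition S V mu,
        Z = colsub (widen_ord rl) V
      & lamhat = colsub (widen_ord rl) mu].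

Definition power_sketch (R : realType) (m n l p : nat) (Psi : 'M[R]_(m, n))
    (Omega : 'M[R]_(n, l)) : 'M[R]_(m, l) :=
  iter p (fun Y => Psi *m (Psi^T *m Y)) (Psi *m Omega).

Definition sketch_preconditioner (R : realType) (m n r o p : nat)
    (rm : (r <= m)%N) (Psi : 'M[R]_(m, n)) (Omega : 'M[R]_(n, sketch_dim m r o))
    (Phat : 'M[R]_m) : Prop :=
  exists (Q : 'M[R]_(m, sketch_dim m r o)) (Z : 'M[R]_(sketch_dim m r o, r))
         (lamhat : 'rV[R]_r),
    [/\ qr_orthonormal_factor (power_sketch p Psi Omega) Q,
        top_eigenpairs (rank_le_sketch_dim o rm)
          ((Q^T *m Psi) *m (Q^T *m Psi)^T) Z lamhat
      & Phat = localized_preconditioner (Q *m Z) lamhat (above_one lamhat)].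

Definition mutually_independent (d : measure_display) (S : measurableType d)
    (R : realType) (Pr : probability S R) (I : finType)
    (X : I -> {RV Pr >-> R}) : Prop :=
  forall (J : {set I}) (B : I -> set R), (forall c, measurable (B c)) ->
    Pr (\bigcap_(c in [set` J]) (X c @^-1` B c)) =
    (\prod_(c in J) Pr (X c @^-1` B c))%E.

Definition standard_gaussian (d : measure_display) (S : measurableType d)
    (R : realType) (Pr : probability S R) (X : {RV Pr >-> R}) : Prop :=
  forall B : set R, measurable B -> distribution Pr X B = normal_prob 0 1 B.

Definition iid_standard_gaussian (d : measure_display) (S : measurableType d)
    (R : realType) (Pr : probability S R) (I : finType)
    (X : I -> {RV Pr >-> R}) : Prop :=
  mutually_independent X /\ (forall c, standard_gaussian (X c)).

(* The random test matrix with entries X, evaluated at the outcome s. *)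
Definition realized_matrix (d : measure_display) (S : measurableType d)
    (R : realType) (Pr : probability S R) (n l : nat)
    (X : 'I_n * 'I_l -> {RV Pr >-> R}) (s : S) : 'M[R]_(n, l) :=
  \matrix_(a < n, b < l) X (a, b) s.

(* Main.v *)
(* By the descent lemma it suffices to bound <G, Phat Psi> from below and
   |Phat Psi|_F from above.  The latter is at most |Psi|_F = sqrt m, because
   Phat is a contraction.  The former is bounded row by row, using
   <g_i, (Phat Psi)_i> = <x_i, (P Psi)_i> + <g_i - x_i, (P Psi)_i>
   + <g_i, ((Phat - P) Psi)_i>.  With chi = sqrt lambda_1:
   - <x_i, (P Psi)_i> = |x_i| (P Gamma)_ii >= |x_i| / chi, since P and Gamma
     are diagonalized together and Gamma_ii = 1;
   - g_i - x_i is a multiple of w_i, of norm at most nu |x_i|, and the rows of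
     P have norm at most 1, so the second term is at least -nu gamma' |x_i|;
   - |((Phat - P) Psi)_i| <= delta chi.
   As |x_i| >= gamma |g_i|, the sum is at least
   |g_i| (eps gamma - delta lambda_1) / chi, and chi <= sqrt m because
   Gamma has trace m. *)
Require Import Defs.
From HB Require Import structures.
From mathcomp Require Import all_boot all_order all_algebra.
From mathcomp Require Import all_classical all_reals all_analysis.
From mathcomp Require Import ring lra.

Set Implicit Arguments.
Unset Strict Implicit.
Unset Printing Implicit Defensive.

Import Order.TTheory GRing.Theory Num.Theory.
Import numFieldNormedType.Exports.

Local Open Scope classical_set_scope.
Local Open Scope ring_scope.

(** * The Frobenius inner product *)

(** The trace form reduces symmetry and the adjoint rules for left and right multiplication to
    identities of the trace. *)
Definition frob {R : realType} {m n : nat} (A B : 'M[R]_(m, n)) : R :=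
  \tr (A *m B^T).

Section Frobenius.
Context {R : realType}.

Lemma frobE m n (A B : 'M[R]_(m, n)) :
  frob A B = \sum_i \sum_j A i j * B i j.
Proof.
rewrite /frob /mxtrace; apply: eq_bigr => i _; rewrite mxE.
by apply: eq_bigr => j _; rewrite mxE.
Qed.

Lemma frobC m n (A B : 'M[R]_(m, n)) : frob A B = frob B A.
Proof. by rewrite /frob -mxtrace_tr trmx_mul trmxK. Qed.

Lemma frobDr m n (A B1 B2 : 'M[R]_(m, n)) :
  frob A (B1 + B2) = frob A B1 + frob A B2.
Proof. by rewrite /frob linearD mulmxDr mxtraceD. Qed.

Lemma frobZr m n a (A B : 'M[R]_(m, n)) : frob A (a *: B) = a * frob A B.
Proof. by rewrite /frob linearZ -scalemxAr mxtraceZ. Qed.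

Lemma frobNr m n (A B : 'M[R]_(m, n)) : frob A (- B) = - frob A B.
Proof. by rewrite -scaleN1r frobZr mulN1r. Qed.

Lemma frobDl m n (A1 A2 B : 'M[R]_(m, n)) :
  frob (A1 + A2) B = frob A1 B + frob A2 B.
Proof. by rewrite ![frob _ B]frobC frobDr. Qed.

Lemma frobZl m n a (A B : 'M[R]_(m, n)) : frob (a *: A) B = a * frob A B.
Proof. by rewrite ![frob _ B]frobC frobZr. Qed.

Lemma frobNl m n (A B : 'M[R]_(m, n)) : frob (- A) B = - frob A B.
Proof. by rewrite ![frob _ B]frobC frobNr. Qed.

Lemma frob_tr m n (A B : 'M[R]_(m, n)) : frob A^T B^T = frob A B.
Proof. by rewrite /frob trmxK mxtrace_mulC -[RHS]mxtrace_tr trmx_mul trmxK. Qed.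

Lemma frob_mull m n q (A : 'M[R]_(m, n)) (B : 'M[R]_(q, n)) (P : 'M[R]_(q, m)) :
  frob (P *m A) B = frob A (P^T *m B).
Proof. by rewrite /frob trmx_mul trmxK mulmxA [RHS]mxtrace_mulC mulmxA. Qed.

Lemma frob_mulr m n q (A : 'M[R]_(m, n)) (B : 'M[R]_(m, q)) (P : 'M[R]_(n, q)) :
  frob (A *m P) B = frob A (B *m P^T).
Proof. by rewrite /frob trmx_mul trmxK mulmxA. Qed.

Lemma frob_rows m n (A B : 'M[R]_(m, n)) :
  frob A B = \sum_i frob (row i A) (row i B).
Proof.
rewrite frobE; apply: eq_bigr => i _; rewrite frobE big_ord1.
by apply: eq_bigr => j _; rewrite !mxE.
Qed.

Lemma frob_rVE n (u v : 'rV[R]_n) : frob u v = \sum_j u 0 j * v 0 j.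
Proof. by rewrite frobE big_ord1. Qed.

Lemma dotvE n (u v : 'rV[R]_n) : dotv u v = frob u v.
Proof. by rewrite frob_rVE. Qed.

Lemma fnormE m n (A : 'M[R]_(m, n)) : fnorm A = Num.sqrt (frob A A).
Proof. by rewrite /fnorm frobE. Qed.

Lemma frob_ge0 m n (A : 'M[R]_(m, n)) : 0 <= frob A A.
Proof.
by rewrite frobE; do 2!apply: sumr_ge0 => ? _; rewrite -expr2 sqr_ge0.
Qed.

Lemma fnorm_ge0 m n (A : 'M[R]_(m, n)) : 0 <= fnorm A.
Proof. exact: sqrtr_ge0. Qed.

Lemma sqr_fnorm m n (A : 'M[R]_(m, n)) : fnorm A ^+ 2 = frob A A.
Proof. by rewrite fnormE sqr_sqrtr // frob_ge0. Qed.

Lemma frob_eq0 m n (A : 'M[R]_(m, n)) : (frob A A == 0) = (A == 0).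
Proof.
apply/eqP/eqP => [|->]; last by rewrite /frob mul0mx mxtrace0.
rewrite frobE => /psumr_eq0P A0; apply/matrixP => i j; rewrite mxE.
have /psumr_eq0P/(_ j isT) : \sum_j A i j * A i j = 0.
  by apply: A0 => // k _; apply: sumr_ge0 => ? _; rewrite -expr2 sqr_ge0.
move=> H; apply/eqP; rewrite -sqrf_eq0 expr2; apply/eqP/H => k _.
by rewrite -expr2 sqr_ge0.
Qed.

Lemma fnorm_eq0 m n (A : 'M[R]_(m, n)) : (fnorm A == 0) = (A == 0).
Proof. by rewrite -frob_eq0 -sqr_fnorm sqrf_eq0. Qed.

Lemma fnorm_gt0 m n (A : 'M[R]_(m, n)) : (0 < fnorm A) = (A != 0).
Proof. by rewrite lt_def fnorm_ge0 andbT fnorm_eq0. Qed.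

Lemma fnormZ m n a (A : 'M[R]_(m, n)) : fnorm (a *: A) = `|a| * fnorm A.
Proof.
rewrite !fnormE frobZl frobZr mulrA -expr2 sqrtrM ?sqr_ge0 //.
by rewrite sqrtr_sqr.
Qed.

Lemma fnorm_tr m n (A : 'M[R]_(m, n)) : fnorm A^T = fnorm A.
Proof. by rewrite !fnormE frob_tr. Qed.

(** Cauchy-Schwarz: expand the squared norm of [frob B B *: A - frob A B *: B] and cancel one factor
    [frob B B]. *)
Lemma frob_sqr_le m n (A B : 'M[R]_(m, n)) :
  frob A B ^+ 2 <= frob A A * frob B B.
Proof.
have [/eqP B0|Bn0] := eqVneq (frob B B) 0.
  move: B0; rewrite frob_eq0 => /eqP ->.
  by rewrite -(scale0r (0 : 'M[R]_(m, n))) !frobZr !mul0r expr0n mulr0.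
have Bgt0 : 0 < frob B B by rewrite lt_def Bn0 frob_ge0.
have := frob_ge0 (frob B B *: A - frob A B *: B).
rewrite !(frobDl, frobDr, frobNl, frobNr, frobZl, frobZr) (frobC B A).
set a := frob A A; set b := frob B B; set c := frob A B => H.
have : 0 <= b * (a * b - c ^+ 2) by apply: le_trans H _; rewrite le_eqVlt; apply/orP; left; apply/eqP; ring.
by rewrite pmulr_rge0 // subr_ge0.
Qed.

Lemma ler_norm_frob m n (A B : 'M[R]_(m, n)) :
  `|frob A B| <= fnorm A * fnorm B.
Proof.
rewrite -(@ler_pXn2r _ 2) ?nnegrE ?mulr_ge0 ?fnorm_ge0 //.
by rewrite real_normK ?num_real // exprMn !sqr_fnorm frob_sqr_le.
Qed.

Lemma frob_le m n (A B : 'M[R]_(m, n)) : frob A B <= fnorm A * fnorm B.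
Proof. exact: le_trans (ler_norm _) (ler_norm_frob A B). Qed.

Lemma frob_ge m n (A B : 'M[R]_(m, n)) : - (fnorm A * fnorm B) <= frob A B.
Proof. by have := ler_norm_frob A B; rewrite ler_norml => /andP[]. Qed.

(** The l2 norm of the vector of row norms is at most its l1 norm; this turns bounds proved row by
    row into a bound on the whole gradient. *)
Lemma fnorm_le_sum_rows m n (A : 'M[R]_(m, n)) :
  fnorm A <= \sum_i fnorm (row i A).
Proof.
rewrite -(@ler_pXn2r _ 2) ?nnegrE ?fnorm_ge0 ?sumr_ge0 // => [|i _]; last first.
  exact: fnorm_ge0.
rewrite sqr_fnorm frob_rows expr2 mulr_suml ler_sum // => i _.
rewrite -sqr_fnorm expr2 ler_wpM2l ?fnorm_ge0 // (bigD1 i) //= lerDl.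
by rewrite sumr_ge0 // => j _; exact: fnorm_ge0.
Qed.

Lemma fnorm_mulmx_le m n q (A : 'M[R]_(m, n)) (B : 'M[R]_(n, q)) :
  fnorm (A *m B) <= fnorm A * fnorm B.
Proof.
rewrite -(@ler_pXn2r _ 2) ?nnegrE ?mulr_ge0 ?fnorm_ge0 //.
rewrite exprMn !sqr_fnorm -(frob_tr B) [frob A _]frob_rows [frob B^T _]frob_rows.
rewrite frobE mulr_suml ler_sum // => i _.
rewrite mulr_sumr ler_sum // => j _; rewrite -expr2.
have -> : (A *m B) i j = frob (row i A) (row j B^T).
  by rewrite mxE frob_rVE; apply: eq_bigr => k _; rewrite !mxE.
exact: frob_sqr_le.
Qed.

(** The [sup] is an upper bound only if its set is bounded; submultiplicativity of [fnorm] gives the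
    bound [fnorm A]. *)
Lemma fnorm_mulmx_le_opnorm m n (A : 'M[R]_(m, n)) (x : 'cV[R]_n) :
  fnorm x <= 1 -> fnorm (A *m x) <= opnorm A.
Proof.
move=> x1; apply: ub_le_sup; last by exists x.
exists (fnorm A) => _ [y y1 <-]; apply: le_trans (fnorm_mulmx_le _ _) _.
by rewrite -[leRHS]mulr1 ler_wpM2l ?fnorm_ge0.
Qed.

Lemma fnorm_delta m n (i : 'I_m) (j : 'I_n) :
  fnorm (delta_mx i j : 'M[R]_(m, n)) = 1.
Proof.
rewrite fnormE frobE (bigD1 i) //= (bigD1 j) //= !mxE !eqxx mulr1.
rewrite !big1 ?addr0 ?sqrtr1 // => [k ki|k kj]; last first.
  by rewrite !mxE (negbTE kj) andbF mulr0.
by apply: big1 => l _; rewrite !mxE (negbTE ki) mulr0.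
Qed.

(** Zero vectors are covered, because the inverse of 0 is 0; the [acos] rules below thus hold for
    all vectors. *)
Lemma cosine_bound n (u v : 'rV[R]_n) :
  -1 <= frob u v / (fnorm u * fnorm v) <= 1.
Proof.
rewrite -ler_norml.
have [->|uv0] := eqVneq (fnorm u * fnorm v) 0.
  by rewrite invr0 mulr0 normr0.
have uv_gt0 : 0 < fnorm u * fnorm v by rewrite lt_def uv0 mulr_ge0 ?fnorm_ge0.
by rewrite normrM normfV (gtr0_norm uv_gt0) ler_pdivrMr // mul1r ler_norm_frob.
Qed.

Lemma cos_angle n (u v : 'rV[R]_n) :
  cos (angle u v) = frob u v / (fnorm u * fnorm v).
Proof. by rewrite /angle dotvE acosK // in_itv /= cosine_bound. Qed.

Lemma sin_angle n (u v : 'rV[R]_n) :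
  sin (angle u v) = Num.sqrt (1 - (frob u v / (fnorm u * fnorm v)) ^+ 2).
Proof. by rewrite /angle dotvE sin_acos // cosine_bound. Qed.

(* Any multiple of [w], not only the orthogonal projection, leaves a residual
   of length at least the distance [fnorm g * sin] to the line of [w]. *)
Lemma sin_angle_le_residual n (g w : 'rV[R]_n) (a : R) : w != 0 ->
  fnorm g * sin (angle g w) <= fnorm (g - a *: w).
Proof.
rewrite -fnorm_gt0 => w_gt0.
have [->|] := eqVneq g 0.
  by rewrite fnormE /frob mul0mx mxtrace0 sqrtr0 mul0r fnorm_ge0.
rewrite -fnorm_gt0 => g_gt0.
rewrite -(@ler_pXn2r _ 2) ?nnegrE ?mulr_ge0 ?fnorm_ge0 //; last first.
  by rewrite sin_angle sqrtr_ge0.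
rewrite sin_angle exprMn [X in _ * X]sqr_sqrtr; last first.
  rewrite subr_ge0 -[leRHS](expr1n _ 2) -real_normK ?num_real //.
  by rewrite lerXn2r ?nnegrE // ler_norml cosine_bound.
rewrite [leRHS]sqr_fnorm.
rewrite !(frobDl, frobDr, frobNl, frobNr, frobZl, frobZr) (frobC w g).
rewrite -!sqr_fnorm; set c := frob g w; set x := fnorm g; set y := fnorm w.
have -> : x ^+ 2 * (1 - (c / (x * y)) ^+ 2) = x ^+ 2 - c ^+ 2 / y ^+ 2.
  by field; rewrite !gt_eqF.
rewrite -subr_ge0.
(* The gap is a perfect square, zero exactly when [a *: w] is the orthogonal projection of [g]. *)
have -> : x ^+ 2 - a * c + (- (a * c) - a * - (a * y ^+ 2)) -
    (x ^+ 2 - c ^+ 2 / y ^+ 2) = (a * y - c / y) ^+ 2.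
  by field; rewrite gt_eqF.
exact: sqr_ge0.
Qed.

End Frobenius.

(** * Localized preconditioners *)

(** The spectrum of the preconditioner minus the identity, padded by 0 outside [C] so that sums run
    over all columns of [U]. *)
Definition localized_shift {R : realType} {q : nat} (lam : 'rV[R]_q)
    (C : {set 'I_q}) : 'rV[R]_q :=
  \row_j (if j \in C then (Num.sqrt (lam 0 j))^-1 - 1 else 0).

Section LocalizedPreconditioner.
Context {R : realType}.

Lemma localized_preconditionerE m q (U : 'M[R]_(m, q)) (lam : 'rV[R]_q)
    (C : {set 'I_q}) :
  localized_preconditioner U lam C =
  1%:M + U *m diag_mx (localized_shift lam C) *m U^T.
Proof.
rewrite /localized_preconditioner; congr (_ + _).
set v := \row_(a < _) _.
have -> : diag_mx v - 1%:M = diag_mx (v - const_mx 1).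
  by rewrite linearB /= diag_const_mx.
rewrite !mul_mx_diag; apply/matrixP => i k; rewrite !mxE.
rewrite [RHS](bigID (fun j => j \in C)) /= [X in _ = _ + X]big1 ?addr0; last first.
  by move=> j /negbTE jC; rewrite !mxE jC mulr0 mul0r.
rewrite [RHS]big_enum_val; apply: eq_bigr => a _.
by rewrite !mxE enum_valP.
Qed.

Lemma localized_preconditioner_sym m q (U : 'M[R]_(m, q)) (lam : 'rV[R]_q)
    (C : {set 'I_q}) :
  (localized_preconditioner U lam C)^T = localized_preconditioner U lam C.
Proof.
rewrite localized_preconditionerE linearD /= trmx1 !trmx_mul trmxK tr_diag_mx.
by rewrite mulmxA.
Qed.

Lemma localized_shift_bound q (lam : 'rV[R]_q) (C : {set 'I_q}) (j : 'I_q) :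
  C \subset above_one lam -> -1 <= localized_shift lam C 0 j <= 0.
Proof.
move=> /fintype.subsetP CA; rewrite mxE; case: ifPn => [/CA|_]; last first.
  by rewrite lexx oppr_le0 ler01.
rewrite inE => lam1; rewrite lerBrDl subrr subr_le0 invr_ge0 sqrtr_ge0 /=.
by rewrite invf_le1 ?sqrtr_gt0 ?(lt_trans ltr01) // -[leLHS]sqrtr1 ler_wsqrtr // ltW.
Qed.

(** With [Y = U^T *m B], orthonormality of the columns makes the change in squared norm the sum of
    [d (2 + d) Y_jk^2], and [-1 <= d <= 0]. [U] may be rectangular, so the sketch is covered too. *)
Lemma fnorm_localized_preconditioner_le m q n (U : 'M[R]_(m, q))
    (lam : 'rV[R]_q) (C : {set 'I_q}) (B : 'M[R]_(m, n)) :
  U^T *m U = 1%:M -> C \subset above_one lam ->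
  fnorm (localized_preconditioner U lam C *m B) <= fnorm B.
Proof.
move=> UU CA; rewrite localized_preconditionerE; set d := localized_shift lam C.
rewrite -(@ler_pXn2r _ 2) ?nnegrE ?fnorm_ge0 // !sqr_fnorm.
set Y := U^T *m B.
have -> : (1%:M + U *m diag_mx d *m U^T) *m B = B + U *m (diag_mx d *m Y).
  by rewrite mulmxDl mul1mx -!mulmxA.
rewrite frobDl !frobDr.
have -> : frob (U *m (diag_mx d *m Y)) (U *m (diag_mx d *m Y)) =
    frob (diag_mx d *m Y) (diag_mx d *m Y).
  by rewrite frob_mull mulmxA UU mul1mx.
rewrite (frobC B (U *m _)) frob_mull -/Y !frobE -addrA gerDl -!big_split /=.
apply: sumr_le0 => j _; rewrite -!big_split /=; apply: sumr_le0 => k _.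
have /andP[d1 d0] := localized_shift_bound j CA; rewrite -/d in d1 d0.
have -> : (diag_mx d *m Y) j k = d 0 j * Y j k by rewrite mul_diag_mx mxE.
set y := Y j k.
have -> : d 0 j * y * y + (d 0 j * y * y + d 0 j * y * (d 0 j * y)) =
  d 0 j * (2 + d 0 j) * y ^+ 2 by ring.
by rewrite mulr_le0_ge0 ?sqr_ge0 // mulr_le0_ge0 //; lra.
Qed.

(** By symmetry row [i] is the image of a unit basis vector under a contraction. *)
Lemma fnorm_row_localized_preconditioner_le m q (U : 'M[R]_(m, q))
    (lam : 'rV[R]_q) (C : {set 'I_q}) (i : 'I_m) :
  U^T *m U = 1%:M -> C \subset above_one lam ->
  fnorm (row i (localized_preconditioner U lam C)) <= 1.
Proof.
move=> UU CA; rewrite -fnorm_tr tr_row localized_preconditioner_sym colE.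
apply: le_trans (fnorm_localized_preconditioner_le _ UU CA) _.
by rewrite fnorm_delta.
Qed.

End LocalizedPreconditioner.

(** * Spectral estimates for the Gram matrix *)

Section GramSpectrum.
Context {R : realType} {m n : nat}.
Variables (Psi : 'M[R]_(m, n)) (U : 'M[R]_m) (lam : 'rV[R]_m).
Hypothesis eigen : eigendecomposition (Psi *m Psi^T) U lam.

Let UU : U *m U^T = 1%:M.
Proof. by case: eigen => UtU _ _ _; exact: mulmx1C. Qed.

Lemma frob_row_mul_gram (v w : 'rV[R]_m) :
  frob (v *m Psi) (w *m Psi) = \sum_j (v *m U) 0 j * lam 0 j * (w *m U) 0 j.
Proof.
case: eigen => _ gramE _ _.
rewrite frob_mulr frobC -mulmxA gramE !mulmxA frob_mulr trmxK frobC.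
by rewrite mul_mx_diag frob_rVE; apply: eq_bigr => j _; rewrite [X in _ * X]mxE; ring.
Qed.

Lemma frob_row_mul_orthogonal (v w : 'rV[R]_m) :
  frob (v *m U) (w *m U) = frob v w.
Proof. by rewrite frob_mulr -mulmxA UU mulmx1. Qed.

Lemma fnorm_row_mul_le (l : R) (v : 'rV[R]_m) :
  0 <= l -> (forall j, lam 0 j <= l) ->
  fnorm (v *m Psi) <= Num.sqrt l * fnorm v.
Proof.
move=> l0 laml.
rewrite -(@ler_pXn2r _ 2) ?nnegrE ?mulr_ge0 ?sqrtr_ge0 ?fnorm_ge0 //.
rewrite exprMn [X in _ <= X * _]sqr_sqrtr // !sqr_fnorm frob_row_mul_gram.
rewrite -(frob_row_mul_orthogonal v v) frob_rVE mulr_sumr ler_sum // => j _.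
by rewrite mulrAC mulrC ler_wpM2r // -expr2 sqr_ge0.
Qed.

Lemma trace_gram : \tr (Psi *m Psi^T) = \sum_j lam 0 j.
Proof.
case: eigen => UtU -> _ _; rewrite mxtrace_mulC mulmxA UtU mul1mx.
by rewrite mxtrace_diag.
Qed.

(* [U] diagonalizes both the preconditioner and the Gram matrix, and in each
   eigendirection the product of eigenvalues is [sqrt lam] or [lam], hence at
   least [lam / sqrt l] as soon as [1 <= l] bounds the spectrum. *)
Lemma frob_preconditioned_row_ge (C : {set 'I_m}) (l : R) (i : 'I_m) :
  C \subset above_one lam -> 1 <= l -> (forall j, lam 0 j <= l) ->
  frob (row i Psi) (row i Psi) / Num.sqrt l <=
  frob (row i Psi) (row i (localized_preconditioner U lam C *m Psi)).
Proof.
move=> /fintype.subsetP CA l1 laml; case: eigen => UtU _ _ lam0.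
have l0 : 0 < l by exact: lt_le_trans l1.
have s1 : 1 <= Num.sqrt l by rewrite -[leLHS]sqrtr1 ler_wsqrtr.
have s0 : 0 < Num.sqrt l by exact: lt_le_trans s1.
have rowPsi : row i Psi = row i 1%:M *m Psi by rewrite -row_mul mul1mx.
rewrite row_mul rowPsi.
rewrite !frob_row_mul_gram mulr_suml ler_sum // => j _.
have -> : (row i (localized_preconditioner U lam C) *m U) 0 j =
    (1 + localized_shift lam C 0 j) * (row i 1%:M *m U) 0 j.
  rewrite localized_preconditionerE -!row_mul mulmxDl mul1mx.
  by rewrite -(mulmxA _ U^T) UtU mulmx1 mul_mx_diag !mxE; ring.
rewrite -!row_mul mul1mx [row i U 0 j]mxE.
set u := U i j; set d := localized_shift lam C 0 j.
have -> : u * lam 0 j * ((1 + d) * u) = u ^+ 2 * ((1 + d) * lam 0 j) by ring.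
have -> : u * lam 0 j * u / Num.sqrt l = u ^+ 2 * (lam 0 j / Num.sqrt l) by ring.
rewrite ler_wpM2l ?sqr_ge0 // mulrC ler_wpM2r ?lam0 // /d mxE.
(* Outside [C] the factor [1 + d] is 1; inside it is the inverse root of [lam 0 j]. Both are at
   least the inverse root of [l]. *)
case: ifPn => [/CA|_]; last by rewrite addr0 invf_le1.
rewrite inE => lamj; rewrite addrC subrK lef_pV2 ?posrE ?sqrtr_gt0 //.
  by rewrite ler_wsqrtr.
exact: lt_trans lamj.
Qed.

End GramSpectrum.

(** * The descent inequality *)

Section Descent.
Context {R : realType} {a b : nat}.
Implicit Types (f : 'M[R]_(a, b) -> R) (W H : 'M[R]_(a, b)).

Lemma derive_gradient f W H :
  differentiable f W -> 'D_H f W = frob (gradient f W) H.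
Proof.
move=> df; rewrite deriveE // [in LHS](matrix_sum_delta H) linear_sum frobE.
apply: eq_bigr => i _; rewrite linear_sum; apply: eq_bigr => j _.
by rewrite linearZ /= -deriveE // mxE mulrC.
Qed.

Lemma is_derive_line f W H (s : R) : differentiable f (W + s *: H) ->
  is_derive s 1 (fun s : R => f (W + s *: H))
    (frob (gradient f (W + s *: H)) H).
Proof.
move=> df; have dH := diff_derivable (v := H) df.
have lineE : (fun h : R => h^-1 *: (((fun s : R => f (W + s *: H)) \o shift s)
      (h *: 1) - f (W + s *: H))) =
    (fun h : R => h^-1 *: ((f \o shift (W + s *: H)) (h *: H)
      - f (W + s *: H))).
  apply/funext => h /=; congr (_ *: (f _ - _)).
  by rewrite scalerDl [h *: 1]mulr1 addrCA.
by split; [rewrite /derivable lineE | rewrite -derive_gradient // /derive lineE].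
Qed.

(** The mean value theorem replaces integration: [g] is [f] along the segment minus its quadratic
    model, and Cauchy-Schwarz with the Lipschitz bound gives [dg s <= 0] on the unit interval, so
    [g 1 <= g 0]. *)
Lemma descent_lemma f (L : R) W H : smooth_fun L f ->
  f (W + H) <= f W + frob (gradient f W) H + L / 2 * fnorm H ^+ 2.
Proof.
move=> [df Lf].
pose g (s : R) := f (W + s *: H) - (s * frob (gradient f W) H
  + s ^+ 2 * (L / 2 * fnorm H ^+ 2)).
pose dg (s : R) := frob (gradient f (W + s *: H)) H - (frob (gradient f W) H
  + (s + s) * (L / 2 * fnorm H ^+ 2)).
have g_der (s : R) : is_derive s 1 g (dg s).
  have line := is_derive_line (df (W + s *: H)).
  apply: is_deriveB; apply: is_derive_eq.
  rewrite /GRing.scale /=; ring.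
have [|s /itvP s01] := @MVT R g dg 0 1 ltr01 (fun s _ => g_der s).
  by apply: derivable_within_continuous => s _; case: (g_der s).
rewrite subr0 mulr1 => gE.
have: dg s <= 0.
  rewrite /dg opprD addrA -frobNl -frobDl subr_le0.
  apply: le_trans (frob_le _ _) _.
  apply: le_trans (ler_wpM2r (fnorm_ge0 _) (Lf _ _)) _.
  rewrite addrC addKr fnormZ ger0_norm ?s01 //.
  by rewrite le_eqVlt; apply/orP; left; apply/eqP; field.
by rewrite -gE /g scale0r scale1r addr0; lra.
Qed.

Lemma smooth_fun_ge0 f (L : R) : (0 < a)%N -> (0 < b)%N ->
  smooth_fun L f -> 0 <= L.
Proof.
move=> a0 b0 [_ Lf].
have := Lf (delta_mx (Ordinal a0) (Ordinal b0)) 0.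
by rewrite subr0 fnorm_delta mulr1; apply: le_trans; exact: fnorm_ge0.
Qed.

End Descent.

(** * One step of the preconditioned update *)

Section RowNormalize.
Context {R : realType} {m n : nat}.
Variable X : 'M[R]_(m, n).
Hypothesis X_neq0 : forall i, row i X != 0.

Lemma row_row_normalize i :
  row i (row_normalize X) = (fnorm (row i X))^-1 *: row i X.
Proof. by rewrite rowK. Qed.

Lemma row_row_normalizeK i :
  row i X = fnorm (row i X) *: row i (row_normalize X).
Proof. by rewrite row_row_normalize scalerA divff ?scale1r // fnorm_eq0. Qed.

Lemma frob_row_normalize i :
  frob (row i (row_normalize X)) (row i (row_normalize X)) = 1.
Proof.
rewrite row_row_normalize frobZl frobZr -sqr_fnorm.
by field; rewrite fnorm_eq0.
Qed.

Lemma fnorm_row_row_normalize i : fnorm (row i (row_normalize X)) = 1.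
Proof. by rewrite fnormE frob_row_normalize sqrtr1. Qed.

Lemma sqr_fnorm_row_normalize : fnorm (row_normalize X) ^+ 2 = m%:R.
Proof.
rewrite sqr_fnorm frob_rows (eq_bigr (fun=> 1)) => [|i _]; last first.
  exact: frob_row_normalize.
by rewrite sumr_const card_ord.
Qed.

(** Unit rows give the Gram matrix trace [m], so its [m] nonnegative eigenvalues have mean 1 and sum
    [m]. *)
Lemma largest_eigenvalue_bounds (m_gt0 : (0 < m)%N) (U : 'M[R]_m)
    (lam : 'rV[R]_m) :
  eigendecomposition (row_normalize X *m (row_normalize X)^T) U lam ->
  1 <= largest_eigenvalue m_gt0 lam <= m%:R.
Proof.
move=> eigen; have := trace_gram eigen.
rewrite -/(frob _ _) -sqr_fnorm sqr_fnorm_row_normalize => sumE.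
case: eigen => _ _ lam_decr lam_ge0; apply/andP; split; last first.
  rewrite sumE (bigD1 (Ordinal m_gt0)) //= lerDl.
  by apply: sumr_ge0 => j _; exact: lam_ge0.
have m0 : 0 < m%:R :> R by rewrite ltr0n.
rewrite -(ler_pM2l m0) mulr1 [leLHS]sumE.
have -> : m%:R * largest_eigenvalue m_gt0 lam =
    \sum_(j < m) largest_eigenvalue m_gt0 lam.
  by rewrite sumr_const card_ord mulr_natl.
by apply: ler_sum => j _; exact: lam_decr.
Qed.

End RowNormalize.

Section OneStep.
Context {R : realType} {m n : nat} (m_gt0 : (0 < m)%N).
Variables (G W : 'M[R]_(m, n)).
Let X := relaxed_tangent G W.
Let Psi := row_normalize X.
Variables (U : 'M[R]_m) (lam : 'rV[R]_m) (C : {set 'I_m}).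
Let P := localized_preconditioner U lam C.
Let l1 := largest_eigenvalue m_gt0 lam.
Hypothesis X_neq0 : forall i, row i X != 0.
Hypothesis W_neq0 : forall i, row i W != 0.
Hypothesis eigen : eigendecomposition (Psi *m Psi^T) U lam.
Hypothesis C_above : C \subset above_one lam.
Variables (gamma gamma' nu eps delta : R).
Hypothesis sin_ge : forall i, gamma <= sin (angle (row i G) (row i W)).
Hypothesis cos_le : forall i,
  Num.sqrt (\sum_(j < m) cos (angle (row j Psi) (row i W)) ^+ 2) <= gamma'.
Hypothesis nu_ge : forall i,
  fnorm (row i G - row i X) / fnorm (row i X) <= nu.
Hypothesis nu_small : nu * gamma' * Num.sqrt l1 <= 1 - eps.
Hypothesis eps_ge0 : 0 <= eps.
Variable Phat : 'M[R]_m.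
Hypothesis Phat_close : forall i, fnorm (row i (Phat - P)) <= delta.

Let l1_ge1 : 1 <= l1.
Proof. by have /andP[] := largest_eigenvalue_bounds X_neq0 m_gt0 eigen. Qed.

Let chi_gt0 : 0 < Num.sqrt l1.
Proof. by rewrite sqrtr_gt0 (lt_le_trans ltr01). Qed.

Let lam_le j : lam 0 j <= l1.
Proof. by case: eigen => _ _ lam_decr _; exact: lam_decr. Qed.

Lemma tangent_row_ge i : fnorm (row i G) * gamma <= fnorm (row i X).
Proof.
apply: le_trans (ler_wpM2l (fnorm_ge0 _) (sin_ge i)) _.
by rewrite rowK; exact: sin_angle_le_residual.
Qed.

Lemma tangent_row_alignment i :
  fnorm (row i X) / Num.sqrt l1 <= frob (row i X) (row i (P *m Psi)).
Proof.
rewrite [in leRHS](row_row_normalizeK X_neq0) frobZl ler_wpM2l ?fnorm_ge0 //.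
have := frob_preconditioned_row_ge eigen i C_above l1_ge1 lam_le.
by rewrite frob_row_normalize // mul1r.
Qed.

(** The removed part of the gradient row is a multiple of [row i W], and pairing that row with row
    [i] of [P *m Psi] amounts to pairing [row i W *m Psi^T] with [row i P]. The former has entries
    [fnorm (row i W)] times the cosines controlled by [gamma']; the latter has norm at most 1. *)
Lemma normal_row_alignment i :
  - (fnorm (row i X) * (nu * gamma')) <=
  frob (row i G - row i X) (row i (P *m Psi)).
Proof.
have gamma'_ge0 : 0 <= gamma' by apply: le_trans (cos_le i); exact: sqrtr_ge0.
set a := dotv (row i G) (row i W).
have nE : row i G - row i X = a *: row i W by rewrite [row i X]rowK subKr.
have WP : fnorm (row i W *m Psi^T) <= fnorm (row i W) * gamma'.
  apply: le_trans (ler_wpM2l (fnorm_ge0 _) (cos_le i)).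
  rewrite fnormE frob_rVE -{1}(ger0_norm (fnorm_ge0 (row i W))) -sqrtr_sqr.
  rewrite -sqrtrM ?sqr_ge0 // ler_wsqrtr // mulr_sumr ler_sum // => j _.
  have -> : (row i W *m Psi^T) 0 j = frob (row j Psi) (row i W).
    by rewrite mxE frob_rVE; apply: eq_bigr => k _; rewrite !mxE mulrC.
  rewrite cos_angle fnorm_row_row_normalize // mul1r -expr2 -exprMn.
  by rewrite mulrCA divff ?mulr1 // fnorm_eq0.
have P_row : fnorm (row i P) <= 1.
  by apply: fnorm_row_localized_preconditioner_le => //; case: eigen.
have nX : fnorm (row i G - row i X) <= nu * fnorm (row i X).
  by rewrite -ler_pdivrMr ?fnorm_gt0.
have fW : `|frob (row i W) (row i (P *m Psi))| <= fnorm (row i W) * gamma'.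
  rewrite row_mul frobC frob_mulr frobC.
  apply: le_trans (ler_norm_frob _ _) _; rewrite -[leRHS]mulr1.
  by rewrite ler_pM ?fnorm_ge0.
have : `|frob (row i G - row i X) (row i (P *m Psi))| <=
    fnorm (row i X) * (nu * gamma').
  rewrite nE frobZl normrM.
  apply: le_trans (ler_wpM2l (normr_ge0 _) fW) _.
  have -> : `|a| * (fnorm (row i W) * gamma') =
      fnorm (row i G - row i X) * gamma' by rewrite nE fnormZ mulrA.
  by rewrite mulrA [_ * nu]mulrC ler_wpM2r.
by rewrite ler_norml => /andP[].
Qed.

Lemma perturbation_row_alignment i :
  - (fnorm (row i G) * (delta * Num.sqrt l1)) <=
  frob (row i G) (row i ((Phat - P) *m Psi)).
Proof.
apply: le_trans (frob_ge _ _); rewrite lerN2 ler_wpM2l ?fnorm_ge0 // row_mul.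
apply: le_trans (fnorm_row_mul_le eigen _ (le_trans ler01 l1_ge1) lam_le) _.
by rewrite mulrC ler_wpM2r ?sqrtr_ge0.
Qed.

(** [D] and [M] are left free so that one pair, built from the maximum of the eigenvalues over time
    and from [maxn m n], serves every step. *)
Lemma update_alignment (D M : R) :
  0 <= D -> D <= eps * gamma - delta * l1 -> m%:R <= M ->
  D / Num.sqrt M * fnorm G <= frob G (Phat *m Psi).
Proof.
move=> D0 DE mM.
have chiM : Num.sqrt l1 <= Num.sqrt M.
  apply: ler_wsqrtr; apply: le_trans mM.
  by have /andP[] := largest_eigenvalue_bounds X_neq0 m_gt0 eigen.
have M0 : 0 < Num.sqrt M by exact: lt_le_trans chiM.
apply: le_trans (_ : D / Num.sqrt M * \sum_i fnorm (row i G) <= _).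
  by rewrite ler_wpM2l ?fnorm_le_sum_rows // divr_ge0 // ltW.
rewrite frob_rows mulr_sumr ler_sum // => i _.
have -> : Phat *m Psi = P *m Psi + (Phat - P) *m Psi.
  by rewrite -mulmxDl addrC subrK.
rewrite linearD /= frobDr -[X in frob X (row i (P *m Psi))](subrK (row i X)).
rewrite frobDl.
have [x g] := (fnorm_ge0 (row i X), fnorm_ge0 (row i G)).
have H1 := tangent_row_ge i; have H2 := tangent_row_alignment i.
have H3 := normal_row_alignment i; have H4 := perturbation_row_alignment i.
apply: le_trans (lerD (lerD H3 H2) H4).
(* Multiplying by chi clears the denominator of the tangent term and turns [delta * chi] into
   [delta * l1]. *)
rewrite -(ler_pM2r chi_gt0).
have chi2 : Num.sqrt l1 * Num.sqrt l1 = l1.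
  by rewrite -expr2 sqr_sqrtr // (le_trans ler01).
have -> : (- (fnorm (row i X) * (nu * gamma')) + fnorm (row i X) / Num.sqrt l1 -
    fnorm (row i G) * (delta * Num.sqrt l1)) * Num.sqrt l1 =
    fnorm (row i X) * (1 - nu * gamma' * Num.sqrt l1) -
    fnorm (row i G) * (delta * l1).
  have := chi_gt0; move: chi2; set c := Num.sqrt l1 => <- c0.
  by field; rewrite gt_eqF.
(* Since chi is at most the root of [M], the factor chi over that root is dropped. What remains
   follows from [DE], [tangent_row_ge] and [nu_small]. *)
apply: le_trans (_ : fnorm (row i G) * D <= _).
  rewrite mulrAC mulrC ler_wpM2l // mulrAC ler_pdivrMr // ler_wpM2l //.
apply: le_trans (ler_wpM2l g DE) _.
rewrite mulrBr lerB //; apply: le_trans (_ : fnorm (row i X) * eps <= _).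
  by rewrite mulrCA mulrC ler_wpM2r.
by rewrite ler_wpM2l // lerBrDr addrC -lerBrDr.
Qed.

End OneStep.

(** * The sketch-based preconditioner *)

Section Sketch.
Context {R : realType} {m n r o p : nat}.
Variables (rm : (r <= m)%N) (Psi : 'M[R]_(m, n)).
Variables (Omega : 'M[R]_(n, sketch_dim m r o)) (Phat : 'M[R]_m).
Hypothesis sketch : sketch_preconditioner p rm Psi Omega Phat.

Lemma sketch_preconditioner_sym : Phat^T = Phat.
Proof.
by case: sketch => Q [Z] [mu] [_ _ ->]; exact: localized_preconditioner_sym.
Qed.

(** [Q *m Z] has orthonormal columns: [Q] does, and [Z] consists of columns of an orthogonal
    matrix. *)
Lemma fnorm_sketch_preconditioner_le q (B : 'M[R]_(m, q)) :
  fnorm (Phat *m B) <= fnorm B.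
Proof.
case: sketch => Q [Z] [mu] [[QQ _] [V] [nu] [[VV _ _ _] -> _] ->].
apply: fnorm_localized_preconditioner_le => //.
rewrite trmx_mul -mulmxA (mulmxA Q^T) QQ mul1mx.
apply/matrixP => i j; have /matrixP/(_ (widen_ord (rank_le_sketch_dim o rm) i)
  (widen_ord (rank_le_sketch_dim o rm) j)) := VV.
by rewrite !mxE => {1}<-; apply: eq_bigr => k _; rewrite !mxE.
Qed.

End Sketch.

(** * Orientation as a Frobenius isometry *)

Section Orientation.
Context {R : realType} (k : bool) {m n : nat}.

Lemma fnorm_orient (A : 'M[R]_(wrows k m n, wcols k m n)) :
  fnorm (orient A) = fnorm A.
Proof. by case: k A => A //=; rewrite fnorm_tr. Qed.

Lemma fnorm_orient_inv (B : 'M[R]_(m, n)) : fnorm (orient_inv k B) = fnorm B.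
Proof. by case: k => //=; rewrite fnorm_tr. Qed.

Lemma frob_orient_inv (A : 'M[R]_(wrows k m n, wcols k m n)) (B : 'M[R]_(m, n)) :
  frob A (orient_inv k B) = frob (orient A) B.
Proof. by case: k A => A //=; rewrite -frob_tr trmxK. Qed.

End Orientation.

(** * Extrema over time and telescoping *)

Section UpTo.
Context {R : realType}.

Lemma le_max_upto T (f : nat -> R) t : (t <= T)%N -> f t <= max_upto T f.
Proof.
by move=> tT; exact: (le_bigmax _ (fun i : 'I_T.+1 => f i) (Ordinal (tT : (t < T.+1)%N))).
Qed.

Lemma min_upto_le T (f : nat -> R) t : (t <= T)%N -> min_upto T f <= f t.
Proof.
by move=> tT; exact: (bigmin_le _ (Ordinal (tT : (t < T.+1)%N)) (fun i : 'I_T.+1 => f i)).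
Qed.

Lemma min_upto_telescope T (a b l0 : R) (v u : nat -> R) : 0 <= a ->
  (forall t, (t <= T)%N -> u t.+1 <= u t - a * v t + b) ->
  l0 <= u T.+1 ->
  T.+1%:R * (a * min_upto T v) <= u 0%N - l0 + T.+1%:R * b.
Proof.
move=> a0 step l0u.
(* The minimum over the full range stays fixed while the number [N] of summed steps grows to
   [T.+1]. *)
have Hle (N : nat) : (N <= T.+1)%N ->
    N%:R * (a * min_upto T v) <= u 0%N - u N + N%:R * b.
  elim: N => [_|N IH NT]; first by rewrite !mul0r subrr addr0.
  have av : a * min_upto T v <= a * v N by rewrite ler_wpM2l // min_upto_le.
  have := IH (ltnW NT); have := step _ NT; move: av.
  rewrite -natr1 !mulrDl !mul1r; lra.
by apply: le_trans (Hle _ (leqnn _)) _; rewrite lerD2r lerB.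
Qed.

End UpTo.

(** * The convergence rate *)

Unset Implicit Arguments.
Set Strict Implicit.
Set Printing Implicit Defensive.

Theorem corollary1 (R : realType) (k : bool) (m n r o p : nat)
  (r_gt0 : (0 < r)%N) (r_le_m : (r <= m)%N)
  (Lo : 'M[R]_(wrows k m n, wcols k m n) -> R) (L Linf : R)
  (Lo_smooth : smooth_fun L Lo)
  (Lo_bounded : forall V, Linf <= Lo V)
  (d : measure_display) (S : measurableType d) (Pr : probability S R)
  (Omega : nat -> 'I_n * 'I_(sketch_dim m r o) -> {RV Pr >-> R})
  (s : S)
  (T : nat) (C : R) (C_gt0 : 0 < C)
  (eta : R) (eta_def : eta = C / Num.sqrt T.+1%:R)
  (W : nat -> 'M[R]_(wrows k m n, wcols k m n))
  (lam : nat -> 'rV[R]_m) (P Phat : nat -> 'M[R]_m)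
  (gamma gamma' eps delta : R)
  (Omega_gaussian : forall t, (t <= T)%N -> iid_standard_gaussian (Omega t))
  (g_neq0 : forall t, (t <= T)%N -> forall i, row i (gbar Lo (W t)) != 0)
  (w_neq0 : forall t, (t <= T)%N -> forall i, row i (orient (W t)) != 0)
  (x_neq0 : forall t, (t <= T)%N -> forall i, row i (tangent_of Lo (W t)) != 0)
  (P_exact : forall t, (t <= T)%N ->
     exact_preconditioner r (Psi_of Lo (W t)) (lam t) (P t))
  (Phat_sketch : forall t, (t <= T)%N ->
     sketch_preconditioner p r_le_m (Psi_of Lo (W t))
       (realized_matrix (Omega t) s) (Phat t))
  (W_step : forall t, (t <= T)%N ->
     W t.+1 = W t - eta *: orient_inv k (Phat t *m Psi_of Lo (W t)))
  (gamma_gt0 : 0 < gamma)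
  (sin_phi : forall t, (t <= T)%N -> forall i,
     gamma <= sin (angle (row i (gbar Lo (W t))) (row i (orient (W t)))))
  (cos_phi' : forall t, (t <= T)%N -> forall i,
     Num.sqrt (\sum_(j < m)
       cos (angle (row j (Psi_of Lo (W t))) (row i (orient (W t)))) ^+ 2)
     <= gamma')
  (eps_gt0 : 0 < eps)
  (nu_chi : max_upto T (fun t => nu_of Lo (W t) * gamma' *
       Num.sqrt (largest_eigenvalue (leq_trans r_gt0 r_le_m) (lam t)))
     <= 1 - eps)
  (delta_ge0 : 0 <= delta)
  (Phat_close : forall t, (t <= T)%N -> opnorm (Phat t - P t) <= delta)
  (delta_small : delta * max_upto T (fun t =>
       largest_eigenvalue (leq_trans r_gt0 r_le_m) (lam t)) < eps * gamma) :
  let Delta0 := Lo (W 0%N) - Linf in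
  let D := eps * gamma - delta * max_upto T (fun t =>
       largest_eigenvalue (leq_trans r_gt0 r_le_m) (lam t)) in
  min_upto T (fun t => fnorm (gradient Lo (W t))) <=
  (Num.sqrt T.+1%:R)^-1 *
    (Delta0 * (maxn m n)%:R `^ (1 / 2) / (D * C)
     + L * C * (maxn m n)%:R `^ (3 / 2) / (2 * D)).
Proof.
lazy zeta; set lmax := max_upto T _ in delta_small *.
set Delta0 := Lo _ - Linf; set D := eps * gamma - _.
have m_gt0 : (0 < m)%N := leq_trans r_gt0 r_le_m.
(* Without columns the rows of the initial matrix would vanish. Positive dimensions then yield
   [0 <= L], which lets [M] bound the quadratic term. *)
have n_gt0 : (0 < n)%N.
  case: (posnP n) => // n0; move: (w_neq0 0%N (leq0n T) (Ordinal m_gt0)).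
  by case/eqP; apply/rowP => -[j jn]; exfalso; rewrite n0 in jn.
have dims_gt0 : (0 < wrows k m n)%N /\ (0 < wcols k m n)%N by case: (k).
have L_ge0 : 0 <= L.
  by apply: smooth_fun_ge0 Lo_smooth; case: dims_gt0.
have D_gt0 : 0 < D by rewrite subr_gt0.
set M : R := (maxn m n)%:R.
have mM : m%:R <= M by rewrite ler_nat leq_maxl.
have M_gt0 : 0 < M by rewrite ltr0n leq_max m_gt0.
have sM_gt0 : 0 < Num.sqrt M by rewrite sqrtr_gt0.
have T_gt0 : 0 < T.+1%:R :> R by rewrite ltr0n.
have sT_gt0 : 0 < Num.sqrt T.+1%:R :> R by rewrite sqrtr_gt0.
have eta_gt0 : 0 < eta by rewrite eta_def divr_gt0.
have step t : (t <= T)%N -> Lo (W t.+1) <= Lo (W t)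
    - (eta * (D / Num.sqrt M)) * fnorm (gradient Lo (W t))
    + L / 2 * (eta ^+ 2 * M).
  move=> tT.
  have [U [A [eigen [A_above _ _] PE]]] := P_exact t tT.
  have sketch := Phat_sketch t tT.
  have Psi_le : fnorm (Phat t *m Psi_of Lo (W t)) ^+ 2 <= M.
    apply: le_trans mM; rewrite -(sqr_fnorm_row_normalize (x_neq0 t tT)).
    rewrite lerXn2r ?nnegrE ?fnorm_ge0 //.
    exact: fnorm_sketch_preconditioner_le sketch _ _.
  (* Both preconditioners are symmetric, so a row of the difference is its value at a unit basis
     vector, which the operator norm controls. *)
  have Phat_row i :
      fnorm (row i (Phat t - localized_preconditioner U (lam t) A)) <= delta.
    rewrite -PE; apply: le_trans (Phat_close t tT).
    rewrite -fnorm_tr tr_row linearB /= (sketch_preconditioner_sym sketch).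
    rewrite PE localized_preconditioner_sym colE.
    by apply: fnorm_mulmx_le_opnorm; rewrite fnorm_delta.
  have align : D / Num.sqrt M * fnorm (gbar Lo (W t)) <=
      frob (gbar Lo (W t)) (Phat t *m Psi_of Lo (W t)).
    apply: (@update_alignment _ _ _ (leq_trans r_gt0 r_le_m) _ _ _ _ _
      (x_neq0 t tT) (w_neq0 t tT) eigen A_above gamma gamma'
      (nu_of Lo (W t)) eps delta (sin_phi t tT) (cos_phi' t tT) _ _
      (ltW eps_gt0) _ Phat_row _ _ (ltW D_gt0) _ mM).
    - by move=> i; exact: (le_bigmax _ (fun i : 'I_m => _) i).
    - apply: le_trans nu_chi.
      exact: (le_max_upto (fun t => nu_of Lo (W t) * gamma' * _) tT).
    - rewrite lerB // ler_wpM2l //.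
      exact: (le_max_upto (fun t => largest_eigenvalue _ (lam t)) tT).
  rewrite W_step //.
  apply: le_trans (descent_lemma _ _ Lo_smooth) _.
  rewrite frobNr frobZr frob_orient_inv -[X in fnorm X]scaleNr fnormZ fnorm_orient_inv.
  rewrite normrN gtr0_norm // exprMn.
  apply: lerD; last by rewrite ler_wpM2l ?divr_ge0 // ler_wpM2l ?sqr_ge0.
  rewrite lerD2l lerN2 -mulrA ler_wpM2l ?(ltW eta_gt0) //.
  by move: align; rewrite /gbar fnorm_orient.
have eta_D_ge0 : 0 <= eta * (D / Num.sqrt M) by rewrite mulr_ge0 ?divr_ge0 ?ltW.
have := min_upto_telescope eta_D_ge0 step (Lo_bounded _).
set mu := min_upto T _ => mu_le.
have -> : M `^ (1 / 2) = Num.sqrt M by rewrite div1r powR12_sqrt // ltW.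
have -> : M `^ (3 / 2) = M * Num.sqrt M.
  have -> : 3 / 2 = 1 + 2^-1 :> R by field.
  rewrite powRD ?powRr1 ?powR12_sqrt ?(ltW M_gt0) //.
  by apply/implyP => _; rewrite gt_eqF.
(* Scaling by this factor makes the left side the telescoped quantity; with the chosen [eta] the two
   upper bounds then coincide, so an identity remains. *)
have scale_gt0 : 0 < T.+1%:R * (eta * (D / Num.sqrt M)).
  by rewrite !mulr_gt0 ?invr_gt0.
rewrite -(ler_pM2l scale_gt0) -[leLHS]mulrA.
apply: le_trans mu_le _; rewrite -/Delta0 eta_def.
have sT2 : T.+1%:R = Num.sqrt T.+1%:R ^+ 2 :> R by rewrite sqr_sqrtr // ltW.
rewrite [T.+1%:R in X in _ <= X * _ * _]sT2.
rewrite le_eqVlt; apply/orP; left; apply/eqP.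
rewrite {1}sT2; move: sT_gt0; set c := Num.sqrt T.+1%:R => c0.
by field; rewrite !gt_eqF.
Qed.
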